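(* For each directed graph $G=(V,E)$ there are disjoint, independent subsets $A$ and $B$ of $V$ such that $V=\mathrm{Out}_2(A)\cup\mathrm{In}_2(B)$.
   Context: Digraphs $G=(V,E)$, $E\subseteq V\times V$, may be infinite. A set $A\subseteq V$ is independent if there is no edge (in either direction) between two distinct elements of $A$. $\mathrm{Out}_2(A)$ is the set of all $v\in V$ such that there is a directed path of length at most $2$ in $G$ from some point of $A$ to $v$; $\mathrm{In}_2(B)$ is the set of all $v\in V$ such that there is a directed path of length at most $2$ in $G$ from $v$ to some point of $B$. Paths of length $0$ are allowed. *)

(* Defs.v *)
From mathcomp Require Import all_boot.
From mathcomp Require Import mathcomp_extra boolp classical_sets functions.

Set Implicit Arguments.
Unset Strict Implicit.
Unset Printing Implicit Defensive.

Local Open Scope classical_set_scope.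

(* A digraph is a type V of vertices, of any cardinality and possibly empty,
   with an arbitrary set E of ordered pairs as its edges; loops and pairs of
   opposite edges are allowed. *)

Definition independent (V : Type) (E : set (V * V)) (A : set V) : Prop :=
  forall x y : V, A x -> A y -> x <> y -> ~ E (x, y) /\ ~ E (y, x).

(* The path is p 0, ..., p n; the values of p beyond n play no role. *)
Definition dipath (V : Type) (E : set (V * V)) (n : nat) (u v : V) : Prop :=
  exists p : nat -> V,
    [/\ p 0%N = u, p n = v,
        set_inj [set i | (i <= n)%N] p
      & forall i : nat, (i < n)%N -> E (p i, p i.+1)].

Definition Out (V : Type) (E : set (V * V)) (k : nat) (A : set V) : set V :=
  [set v | exists2 a, A a & exists2 n, (n <= k)%N & dipath E n a v].

Definition In (V : Type) (E : set (V * V)) (k : nat) (B : set V) : set V :=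
  [set v | exists2 b, B b & exists2 n, (n <= k)%N & dipath E n v b].

(* Main.v *)
(** Let [I] be a maximal independent set, [R] the set of vertices that are
    neither in [I] nor an out-neighbour of [I], and [J] a maximal independent
    subset of [R]. Every vertex of [R] has an edge to [I], and no edge goes from
    [I] to [R]. Hence [A], the union of [J] and of the points of [I] that are not
    out-neighbours of [J], is independent. Take for [B] the rest of [I]. A vertex
    outside [R] is in [I] or is an out-neighbour of [I], and the points of [I]
    missing from [A] lie in [B] and are one step away from [J]. A vertex of [R]
    outside [J] is adjacent to [J]; if its edge goes to [j] in [J], then an edge
    from [j] to [I] ends in [B]. *)

Require Import Defs.
From mathcomp Require Import all_boot.
From mathcomp Require Import mathcomp_extra boolp classical_sets functions.

Local Open Scope classical_set_scope.

Lemma dipath0 (V : Type) (E : set (V * V)) (u : V) : dipath E 0 u u.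
Proof.
by exists (fun=> u); split=> // -[|i] [|j] //; rewrite !inE.
Qed.

Lemma dipath1 (V : Type) (E : set (V * V)) (u v : V) :
  u <> v -> E (u, v) -> dipath E 1 u v.
Proof.
(* The default value of [nth] supplies the endpoint [v]. *)
move=> uv Euv; exists (nth v [:: u]); split=> //; last by case.
by move=> [|[|i]] [|[|j]] //; rewrite !inE //= => _ _ // /esym.
Qed.

(** A path repeats no vertex, so a loop yields only the path of length 0. *)
Lemma dipath_edge {V : Type} {E : set (V * V)} {u v : V} :
  E (u, v) -> exists2 n, (n <= 1)%N & dipath E n u v.
Proof.
move=> Euv; have [<-|uv] := pselect (u = v).
  by exists 0%N => //; exact: dipath0.
by exists 1%N => //; exact: dipath1.
Qed.

Lemma dipath_edge2 {V : Type} {E : set (V * V)} {u v w : V} :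
  E (u, v) -> E (v, w) -> exists2 n, (n <= 2)%N & dipath E n u w.
Proof.
move=> Euv Evw; have [uv|uv] := pselect (u = v).
  by subst v; have [n n1 ?] := dipath_edge Evw; exists n => //; exact: leqW.
have [vw|vw] := pselect (v = w).
  by subst w; have [n n1 ?] := dipath_edge Euv; exists n => //; exact: leqW.
have [<-|uw] := pselect (u = w); first by exists 0%N => //; exact: dipath0.
exists 2%N => //; exists (nth w [:: u; v]); split=> //; last by case=> [|[|]].
by move=> [|[|[|i]]] [|[|[|j]]] //; rewrite !inE //= => _ _ // /esym.
Qed.

Lemma ex_maximal_independent {V : Type} (E : set (V * V)) (R : set V) :
  exists I : set V,
    [/\ I `<=` R, independent E I
      & forall v, R v -> ~ I v -> exists2 i, I i & E (i, v) \/ E (v, i)].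
Proof.
pose P : set (set V) := [set I | I `<=` R /\ independent E I].
have [F FP totF|I [[IR indI] maxI]] := @Zorn_bigcup V P.
  split=> [v [X /FP[XR _]]|x y [X FX Xx] [Y FY Yy]]; first exact: XR.
  (* Two points of the union of a chain lie together in the larger of the two members containing
     them. *)
  have [XY|YX] := totF X Y FX FY.
    by apply: (FP Y FY).2 => //; exact: XY.
  by apply: (FP X FX).2 => //; exact: YX.
exists I; split=> // v Rv nIv; apply: contrapT => nadj.
have vI i : I i -> ~ E (i, v) /\ ~ E (v, i).
  by move=> Ii; split=> Evi; apply: nadj; exists i => //; [left|right].
apply: (maxI (v |` I)).
  by split=> [|vII]; [exact: subsetUr|apply: nIv; apply: vII; left].
split=> [x [->|/IR] //|x y [->|Ix] [->|Iy] xy //].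
- by have [] := vI _ Iy.
- exact: vI.
- exact: indI.
Qed.

Theorem theorem6p1 (V : Type) (E : set (V * V)) :
  exists A B : set V,
    [/\ A `&` B = set0,
        independent E A,
        independent E B
      & [set: V] = Out E 2 A `|` In E 2 B].
Proof.
have [I [_ indI maxI]] := ex_maximal_independent E setT.
pose N X := [set v | exists2 x, X x & E (x, v)].
have [J [JR indJ maxJ]] := ex_maximal_independent E (~` (I `|` N I)).
have JnI v : J v -> ~ I v by move=> /JR nv Iv; apply: nv; left.
have JnN v i : J v -> I i -> ~ E (i, v).
  by move=> /JR nv Ii Eiv; apply: nv; right; exists i.
pose A := J `|` (I `\` N J); pose B := I `&` N J.
have path0 X v : X v -> Out E 2 X v.
  by move=> Xv; exists v => //; exists 0%N => //; exact: dipath0.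
exists A, B; split.
- by apply/seteqP; split=> // v [[/JnI Iv [] //|[_ nv] [_ /nv]]].
- move=> x y [Jx|[Ix nx]] [Jy|[Iy ny]] xy.
  + exact: indJ.
  + by split=> [Exy|]; [apply: ny; exists x|exact: JnN].
  + by split=> [|Eyx]; [exact: JnN|apply: nx; exists y].
  + exact: indI.
- by move=> x y [Ix _] [Iy _]; exact: indI.
apply/seteqP; split=> // v _.
have [Iv|nIv] := pselect (I v).
  have [Nv|nNv] := pselect (N J v); last by left; apply: path0; right.
  by right; exists v => //; exists 0%N => //; exact: dipath0.
have [[i Ii Eiv]|nNv] := pselect (N I v); first left.
  (* If [i] is in [N J], it is missing from [A], but then [v] is within two steps of [J]. *)
  have [[j Jj Eji]|nNi] := pselect (N J i).
    by exists j; [left|exact: dipath_edge2 Eji Eiv].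
  exists i; first by right.
  by have [n n1 ?] := dipath_edge Eiv; exists n => //; exact: leqW.
have [Jv|nJv] := pselect (J v); first by left; apply: path0; left.
have [|j Jj [Ejv|Evj]] := maxJ v _ nJv; first by case.
  left; exists j; first by left.
  by have [n n1 ?] := dipath_edge Ejv; exists n => //; exact: leqW.
(* Maximality of [I] makes [j] adjacent to some [i] in [I]. The edge cannot enter [j], so it puts
   [i] in [N J], hence in [B]. *)
have [i Ii [Eij|Eji]] := maxI j Logic.I (JnI _ Jj).
  by have := JnN _ _ Jj Ii Eij.
by right; exists i; [split=> //; exists j|exact: dipath_edge2 Evj Eji].
Qed.
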